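(* For each $n\in\mathbb{N}$ let $G_n$ be a group with $H_b^2(G_n;\mathbb{R})\not\cong 0$, and let $G\in\{\bigoplus_{n\in\mathbb{N}}G_n,\ \prod_{n\in\mathbb{N}}G_n\}$. Then $\operatorname{bcd} G = \infty$. More precisely: There exists a sequence $(\varphi_n)_{n\in\mathbb{N}}\subset H_b^2(G;\mathbb{R})$ such that for all $n\in\mathbb{N}$ we have $$\varphi_0\cup\dots\cup\varphi_{n-1}\neq 0\in H_b^{2\cdot n}(G;\mathbb{R}).$$
   Context: Conventions: $\mathbb{N}$ contains $0$; $\bigoplus_{n\in\mathbb{N}}G_n$ denotes the subgroup of $\prod_{n\in\mathbb{N}}G_n$ of families with finite support. Bounded cohomology: For a group $G$ and $k\in\mathbb{N}$ let $C_k(G;\mathbb{R}) := \bigoplus_{g\in G^k}\mathbb{R}\cdot g$ with boundary operator $\partial_k(g_1,\dots,g_k) = (g_2,\dots,g_k)+\sum_{j=1}^{k-1}(-1)^j (g_1,\dots,g_j g_{j+1},\dots,g_k)+(-1)^k(g_1,\dots,g_{k-1})$, and let $\|\cdot\|_1$ be the $\ell^1$-norm with respect to the basis $G^k$. The bounded cochain complex $C_b^*(G;\mathbb{R})$ is the topological dual of $C_*(G;\mathbb{R})$ with respect to $\|\cdot\|_1$ (bounded linear functionals, with the dual coboundary operator). Its cohomology is the bounded cohomology $H_b^*(G;\mathbb{R})$. The bounded-cohomological dimension is $\operatorname{bcd}(G) := \sup\{n\in\mathbb{N} \mid H_b^n(G;\mathbb{R})\not\cong 0\}\in\mathbb{N}\cup\{\infty\}$.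 Cup-product: the cup-product $H_b^p(G;\mathbb{R})\otimes_{\mathbb{R}} H_b^q(G;\mathbb{R})\to H_b^{p+q}(G;\mathbb{R})$ is induced by sending bounded cochains $f\in C_b^p(G;\mathbb{R})$, $f'\in C_b^q(G;\mathbb{R})$ to the bounded cochain $(g_1,\dots,g_{p+q})\mapsto (-1)^{pq}\cdot f(g_1,\dots,g_p)\cdot f'(g_{p+1},\dots,g_{p+q})$. The empty cup-product (the case $n=0$) is the unit class in $H_b^0(G;\mathbb{R})\cong\mathbb{R}$. *)

(* Defs.v *)
From HB Require Import structures.
From mathcomp.multinomials Require Import freeg.
From mathcomp Require Import all_boot all_order all_algebra.
From mathcomp Require Import generic_quotient ring_quotient.
From mathcomp Require Import boolp classical_sets functions cardinality reals.
From mathcomp Require Import ereal.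

Set Implicit Arguments.
Unset Strict Implicit.
Unset Printing Implicit Defensive.

Import Order.TTheory GRing.Theory Num.Theory.
Local Open Scope ring_scope.
Local Open Scope quotient_scope.

Section LmodQuotient.
Variables (K : pzRingType) (V : lmodType K) (I : submodClosed V).

Fact submod_zmod_closed : zmod_closed I.
Proof.
by split=> [|x y xI yI]; rewrite ?rpred0 // -scaleN1r rpredD // rpredZ.
Qed.
Definition submod_zmodClosed : zmodClosed V := HB.pack (I : {pred V})
  (GRing.isZmodClosed.Build V (I : {pred V}) submod_zmod_closed).

Definition lquot : Type := Quotient.quot submod_zmodClosed.
HB.instance Definition _ := GRing.Zmodule.on lquot.

Definition lquot_pi (x : V) : lquot := \pi_(Quotient.quot submod_zmodClosed) x.
Definition lquot_repr (x : lquot) : V :=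
  repr (x : Quotient.quot submod_zmodClosed).

Lemma lquot_reprK : cancel lquot_repr lquot_pi.
Proof. exact: reprK. Qed.

Lemma lquot_piP (x y : V) : reflect (lquot_pi x = lquot_pi y) (x - y \in I).
Proof. by rewrite (Quotient.idealrBE submod_zmodClosed); apply: eqP. Qed.

Lemma lquot_piD : {morph lquot_pi : x y / x + y}.
Proof. exact: (raddfD \pi_(Quotient.quot submod_zmodClosed)). Qed.

Definition lquot_scale (a : K) (x : lquot) : lquot :=
  lquot_pi (a *: lquot_repr x).

Lemma lquot_piZ a x : lquot_scale a (lquot_pi x) = lquot_pi (a *: x).
Proof.
apply/lquot_piP; rewrite -scalerBr; apply: rpredZ.
by apply/lquot_piP; rewrite lquot_reprK.
Qed.

Fact lquot_scaleA a b x :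
  lquot_scale a (lquot_scale b x) = lquot_scale (a * b) x.
Proof. by rewrite -[x]lquot_reprK !lquot_piZ scalerA. Qed.
Fact lquot_scale1 : left_id 1 lquot_scale.
Proof. by move=> x; rewrite -[x]lquot_reprK lquot_piZ scale1r. Qed.
Fact lquot_scaleDr : right_distributive lquot_scale +%R.
Proof.
move=> a x y; rewrite -[x]lquot_reprK -[y]lquot_reprK.
by rewrite -lquot_piD !lquot_piZ -lquot_piD -scalerDr.
Qed.
Fact lquot_scaleDl x : {morph lquot_scale^~ x : a b / a + b}.
Proof.
by move=> a b; rewrite -[x]lquot_reprK !lquot_piZ -lquot_piD -scalerDl.
Qed.
HB.instance Definition _ := GRing.Zmodule_isLmodule.Build K lquot
  lquot_scaleA lquot_scale1 lquot_scaleDr lquot_scaleDl.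

Fact lquot_pi_linear : linear lquot_pi.
Proof. by move=> a x y; rewrite lquot_piD -lquot_piZ. Qed.
HB.instance Definition _ :=
  GRing.isLinear.Build K V lquot *:%R lquot_pi lquot_pi_linear.

End LmodQuotient.

Section BoundedCohomology.
Variables (R : realType) (G : groupType).

(* The free module C_n(G;R) on the basis G^n. *)
Definition chain (n : nat) : Type := {freeg (n.-tuple G) / R}.
HB.instance Definition _ n := GRing.Lmodule.on (chain n).

Definition simplex n (t : n.-tuple G) : chain n := Freeg [:: (1, t)].

(* The linear extension of [F] from the basis G^n. *)
Definition chain_lift n (M : lmodType R) (F : n.-tuple G -> M) (c : chain n) :
  M := fglift F c.

Lemma chain_sumE n (c : chain n) :
  c = \sum_(t <- dom c) coeff t c *: simplex t.
Proof.
rewrite -[LHS]freeg_sumE; apply: eq_bigr => t _.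
apply/eqP/freeg_eqP => u.
by rewrite coeffU coeffZ coeffU mul1r.
Qed.

Lemma chain_liftB n (M : lmodType R) (F : n.-tuple G -> M) :
  {morph chain_lift F : c d / c - d}.
Proof. exact: lift_is_additive. Qed.

Lemma chain_liftD n (M : lmodType R) (F : n.-tuple G -> M) :
  {morph chain_lift F : c d / c + d}.
Proof.
have F0 : chain_lift F 0 = 0 by rewrite -(subrr 0) chain_liftB subrr.
have FN d : chain_lift F (- d) = - chain_lift F d.
  by rewrite -sub0r chain_liftB F0 sub0r.
by move=> c d; rewrite -{1}[d]opprK chain_liftB FN opprK.
Qed.

Lemma chain_liftE n (M : lmodType R) (F : n.-tuple G -> M) c :
  chain_lift F c = \sum_(t <- dom c) coeff t c *: F t.
Proof.
have F0 : chain_lift F 0 = 0 by rewrite -(subrr 0) chain_liftB subrr.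
rewrite -{1}[c]freeg_sumE (big_morph _ (chain_liftD F) F0).
by apply: eq_bigr => t _; rewrite /chain_lift liftU.
Qed.

Fact chain_lift_linear n (M : lmodType R) (F : n.-tuple G -> M) :
  linear (chain_lift F).
Proof.
move=> a c d; rewrite chain_liftD; congr (_ + _).
have [->|a0] := eqVneq a 0.
  by rewrite !scale0r -(subrr 0) chain_liftB subrr.
rewrite !chain_liftE scaler_sumr.
rewrite (perm_big (dom c)) /=; last first.
  by apply: uniq_perm; rewrite ?uniq_dom //; apply: domZ.
by apply: eq_bigr => t _; rewrite coeffZ scalerA.
Qed.
HB.instance Definition _ n (M : lmodType R) (F : n.-tuple G -> M) :=
  GRing.isLinear.Build R (chain n) M *:%R (chain_lift F) (chain_lift_linear F).

Lemma chain_lift_simplex n (M : lmodType R) (F : n.-tuple G -> M) t :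
  chain_lift F (simplex t) = F t.
Proof. by rewrite /chain_lift liftU scale1r. Qed.

(* The l^1-norm; [dom c] lists the basis elements with a nonzero coefficient. *)
Definition norm1 n (c : chain n) : R := \sum_(t <- dom c) `|coeff t c|.

Lemma norm1_simplex n (t : n.-tuple G) : norm1 (simplex t) = 1.
Proof. by rewrite /norm1 domU1 big_seq1 coeffU eqxx mul1r normr1. Qed.

(* [face j (g_1, ..., g_(n+1))] is [(g_2, ..., g_(n+1))] if [j = 0],
   [(g_1, ..., g_j g_(j+1), ..., g_(n+1))] if [1 <= j <= n], and
   [(g_1, ..., g_n)] if [j = n + 1]; the index [i] below starts at 0. *)
Definition face n (j : nat) (t : n.+1.-tuple G) : n.-tuple G :=
  [tuple if (i.+1 < j)%N then tnth t (widen_ord (leqnSn n) i)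
         else if i.+1 == j
              then (tnth t (widen_ord (leqnSn n) i) * tnth t (lift ord0 i))%g
         else tnth t (lift ord0 i) | i < n].

Definition boundary n : chain n.+1 -> chain n :=
  chain_lift (fun t => \sum_(j < n.+2) (-1) ^+ j *: simplex (face j t)).
HB.instance Definition _ n := GRing.Linear.on (@boundary n).

Definition bounded_functional n : {pred chain n -> R^o} :=
  [pred f : chain n -> R^o | `[< linear f /\
     exists M : R, forall c : chain n, `|f c : R| <= M * norm1 c >]].

Lemma bounded_functionalP n (f : {linear chain n -> R^o}) :
  reflect (exists M : R, forall t, `|f (simplex t) : R| <= M)
          ((f : chain n -> R^o) \in @bounded_functional n).
Proof.
apply: (iffP (asboolP _)) => [[_ [M fM]]|[M fM]].
  by exists M => t; rewrite -[M]mulr1 -(norm1_simplex t).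
split; first exact: linearP.
exists M => c; rewrite [in f c](chain_sumE c) linear_sum /=.
rewrite (le_trans (ler_norm_sum _ _ _))// /norm1 mulr_sumr ler_sum// => t _.
by rewrite linearZ /= normrM mulrC ler_wpM2r.
Qed.

Fact bounded_functional_submod n : submod_closed (@bounded_functional n).
Proof.
split=> [|a f g].
  apply/asboolP; split=> [b c d|]; first by rewrite scaler0 addr0.
  by exists 0 => c; rewrite normr0 mul0r.
move=> /asboolP[lf [M fM]] /asboolP[lg [N gN]]; apply/asboolP; split.
  move=> b c d; rewrite !fctE lf lg !scalerDr !scalerA (mulrC a b).
  by rewrite addrACA.
exists (`|a| * M + N) => c; rewrite fctE mulrDl.
rewrite (le_trans (ler_normD _ _))// lerD// normrM -mulrA.
by rewrite ler_wpM2l.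
Qed.
HB.instance Definition _ n := GRing.isSubmodClosed.Build R (chain n -> R^o)
  (@bounded_functional n) (@bounded_functional_submod n).

Record bcochain n := Bcochain {
  bcochain_fun :> chain n -> R^o ;
  _ : bcochain_fun \in @bounded_functional n }.
HB.instance Definition _ n := [isSub for @bcochain_fun n].
HB.instance Definition _ n := [Choice of bcochain n by <:].
HB.instance Definition _ n := [SubChoice_isSubLmodule of bcochain n by <:].

Fact bcochain_linear n (f : bcochain n) : linear f.
Proof. by case: f => f /= /asboolP[]. Qed.
HB.instance Definition _ n (f : bcochain n) :=
  GRing.isLinear.Build R (chain n) R^o *:%R f (bcochain_linear f).

Lemma bcochain_bounded n (f : bcochain n) :
  exists M : R, forall t, `|f (simplex t) : R| <= M.
Proof. by apply/bounded_functionalP; case: f. Qed.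

Fact coboundary_subproof n (f : bcochain n) :
  (f : chain n -> R^o) \o @boundary n \in @bounded_functional n.+1.
Proof.
have [M fM] := bcochain_bounded f.
apply/(bounded_functionalP (f \o @boundary n)).
exists (\sum_(j < n.+2) M) => t /=.
rewrite [boundary _]chain_lift_simplex linear_sum.
rewrite (le_trans (ler_norm_sum _ _ _))//.
apply: ler_sum => j _; rewrite linearZ /= normrM normrX normrN1 expr1n mul1r.
exact: fM.
Qed.
Definition coboundary n (f : bcochain n) : bcochain n.+1 :=
  Bcochain (coboundary_subproof f).
Fact coboundary_linear n : linear (@coboundary n).
Proof. by move=> a f g; apply: val_inj. Qed.
HB.instance Definition _ n :=
  GRing.isLinear.Build R _ _ _ _ (@coboundary_linear n).

Definition bcocycle_pred n : {pred bcochain n} := [pred f | coboundary f == 0].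
Fact bcocycle_submod n : submod_closed (@bcocycle_pred n).
Proof.
split=> [|a f g]; first by apply/eqP; rewrite linear0.
move=> /eqP f0 /eqP g0; apply/eqP.
by rewrite linearP /= f0 g0 scaler0 addr0.
Qed.
HB.instance Definition _ n := GRing.isSubmodClosed.Build R (bcochain n)
  (@bcocycle_pred n) (@bcocycle_submod n).

Record bcocycle n := Bcocycle {
  bcocycle_val :> bcochain n ;
  _ : bcocycle_val \in @bcocycle_pred n }.
HB.instance Definition _ n := [isSub for @bcocycle_val n].
HB.instance Definition _ n := [Choice of bcocycle n by <:].
HB.instance Definition _ n := [SubChoice_isSubLmodule of bcocycle n by <:].

Lemma bcocycle_coboundary n (f : bcocycle n) : coboundary f = 0.
Proof. by case: f => f /= /eqP. Qed.

(* In degree 0 the incoming coboundary operator is the zero map. *)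
Definition is_bcoboundary n : bcochain n -> Prop :=
  match n with
  | 0 => fun f => f = 0
  | m.+1 => fun f => exists h : bcochain m, f = coboundary h
  end.
Definition bcoboundary_pred n : {pred bcocycle n} :=
  [pred f : bcocycle n | `[< is_bcoboundary f >]].
Fact bcoboundary_submod n : submod_closed (@bcoboundary_pred n).
Proof.
split=> [|a f g].
  by apply/asboolP; case: n => [|n] //=; exists 0; rewrite [RHS]linear0.
move=> /asboolP fB /asboolP gB; apply/asboolP.
have -> : bcocycle_val (a *: f + g) = a *: bcocycle_val f + bcocycle_val g.
  by [].
case: n f g fB gB => [|n] f g /=.
  by move=> -> ->; rewrite scaler0 addr0.
move=> [h ->] [k ->]; exists (a *: h + k).
by rewrite [RHS]linearP.
Qed.
HB.instance Definition _ n := GRing.isSubmodClosed.Build R (bcocycle n)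
  (@bcoboundary_pred n) (@bcoboundary_submod n).

Definition Hb n : Type := lquot (@bcoboundary_pred n).
HB.instance Definition _ n := GRing.Lmodule.on (Hb n).
Definition Hb_class n : bcocycle n -> Hb n :=
  @lquot_pi _ _ (@bcoboundary_pred n).
HB.instance Definition _ n := GRing.Linear.on (@Hb_class n).

Definition front p q (t : (p + q).-tuple G) : p.-tuple G :=
  [tuple tnth t (lshift q i) | i < p].
Definition back p q (t : (p + q).-tuple G) : q.-tuple G :=
  [tuple tnth t (rshift p i) | i < q].

Definition cup_functional p q (f : bcochain p) (g : bcochain q) :
    chain (p + q) -> R^o :=
  chain_lift (fun t => (-1) ^+ (p * q) *
    (f (simplex (front t)) : R) * (g (simplex (back t)) : R) : R^o).
HB.instance Definition _ p q f g := GRing.Linear.on (@cup_functional p q f g).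

Fact cup_functional_subproof p q (f : bcochain p) (g : bcochain q) :
  (cup_functional f g : chain (p + q) -> R^o)
    \in @bounded_functional (p + q).
Proof.
have [M fM] := bcochain_bounded f; have [N gN] := bcochain_bounded g.
apply/(bounded_functionalP (cup_functional f g)); exists (M * N) => t /=.
rewrite [cup_functional _ _ _]chain_lift_simplex -mulrA normrM normrX normrN1.
by rewrite expr1n mul1r normrM ler_pM.
Qed.
Definition cochain_cup p q (f : bcochain p) (g : bcochain q) : bcochain (p + q)
  := Bcochain (cup_functional_subproof f g).

(* A tuple is presented below as the initial segment of a sequence [u]; faces
   and cup-products can then be computed on sequences without degree casts. *)
Definition seqtup n (u : nat -> G) : n.-tuple G := [tuple u i | i < n].

Lemma seqtupP n (t : n.-tuple G) : exists u, t = seqtup n u.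
Proof.
exists (nth 1%g t); apply: eq_from_tnth => i.
by rewrite tnth_mktuple (tnth_nth 1%g).
Qed.

Definition cev n (f : bcochain n) (u : nat -> G) : R :=
  f (simplex (seqtup n u)).

Lemma cev_inj n (f g : bcochain n) : cev f =1 cev g -> f = g.
Proof.
move=> fg; apply/val_inj/funext => c /=.
rewrite [c]chain_sumE !linear_sum; apply: eq_bigr => t _; rewrite !linearZ /=.
by have [u ->] := seqtupP t; congr (_ *: _); apply: fg.
Qed.

Definition seqface (j : nat) (u : nat -> G) (i : nat) : G :=
  if (i.+1 < j)%N then u i else if i.+1 == j then (u i * u i.+1)%g else u i.+1.

Lemma eq_cev n (f : bcochain n) u v : (forall i, (i < n)%N -> u i = v i) ->
  cev f u = cev f v.
Proof.
move=> uv; rewrite /cev; congr (f (simplex _)); apply: eq_from_tnth => i.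
by rewrite !tnth_mktuple uv.
Qed.

Lemma cev_coboundary n (f : bcochain n) u :
  cev (coboundary f) u = \sum_(j < n.+2) (-1) ^+ j * cev f (seqface j u).
Proof.
rewrite /cev /= [boundary _]chain_lift_simplex linear_sum /=.
apply: eq_bigr => j _; rewrite linearZ /=; congr (_ * f (simplex _)).
apply: eq_from_tnth => i.
by rewrite !tnth_mktuple /= /seqface.
Qed.

Definition seqshift p (u : nat -> G) i := u (p + i)%N.

Lemma cev_cup p q (f : bcochain p) (g : bcochain q) u :
  cev (cochain_cup f g) u = (-1) ^+ (p * q) * (cev f u * cev g (seqshift p u)).
Proof.
rewrite /cev /= [cup_functional _ _ _]chain_lift_simplex -mulrA.
by congr (_ * (f (simplex _) * g (simplex _)));
  apply: eq_from_tnth => i; rewrite !tnth_mktuple.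
Qed.

Lemma cev_coboundary_cup p q (f : bcochain p) (g : bcochain q) u :
  cev (coboundary (cochain_cup f g)) u = (-1) ^+ (p * q) *
    (cev (coboundary f) u * cev g (seqshift p.+1 u) +
     (-1) ^+ p * (cev f u * cev (coboundary g) (seqshift p u))).
Proof.
rewrite !cev_coboundary.
under eq_bigr do rewrite cev_cup mulrCA.
rewrite -mulr_sumr; congr (_ * _).
rewrite -addnS -addSn big_split_ord /=.
rewrite [X in _ = X * _ + _]big_ord_recr [X in _ = _ + _ * (_ * X)]big_ord_recl.
rewrite /= expr0 mul1r.
have -> : cev f (seqface p.+1 u) = cev f u.
  by apply: eq_cev => i ip; rewrite /seqface ltnS ip.
have -> : cev g (seqface 0 (seqshift p u)) = cev g (seqshift p.+1 u).
  by apply: eq_cev => i _; rewrite /seqface /seqshift /= addnS addSn.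
under eq_bigr => j _.
  have -> : cev g (seqshift p (seqface j u)) = cev g (seqshift p.+1 u).
    apply: eq_cev => i _; rewrite /seqshift /seqface.
    have jlt : (j < (p + i).+1)%N.
      by rewrite ltnS (@leq_trans p) ?leq_addr // -ltnS.
    by rewrite ltnNge (ltnW jlt) /= gtn_eqF.
  rewrite mulrA; over.
rewrite -mulr_suml.
under [X in _ + X = _]eq_bigr => j _.
  have -> : cev f (seqface (p.+1 + j)%N u) = cev f u.
    by apply: eq_cev => i ip; rewrite /seqface ltnS ltn_addr.
  have -> : cev g (seqshift p (seqface (p.+1 + j)%N u)) =
            cev g (seqface (bump 0 j) (seqshift p u)).
    apply: eq_cev => i _; rewrite /seqshift /seqface /bump /= add1n.
    by rewrite addSn ltnS ltn_add2l ltnS eqSS eqn_add2l addnS eqSS.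
  rewrite addSn -addnS exprD mulrCA -!mulrA; over.
rewrite -!mulr_sumr /= mulrDl -!addrA; congr (_ + _).
rewrite exprS !mulrDr addrA mulN1r !mulNr -[_ * _ * cev g _]mulrA addNr add0r.
by rewrite mulrCA.
Qed.

Lemma cev0 n u : cev (0 : bcochain n) u = 0. Proof. by []. Qed.
Lemma cevB n (f g : bcochain n) u : cev (f - g) u = cev f u - cev g u.
Proof. by []. Qed.
Lemma cevZ n a (f : bcochain n) u : cev (a *: f) u = a * cev f u.
Proof. by []. Qed.

Lemma cochain_cup_bcocycle p q (f : bcochain p) (g : bcochain q) :
  coboundary f = 0 -> coboundary g = 0 -> coboundary (cochain_cup f g) = 0.
Proof.
move=> f0 g0; apply: cev_inj => u.
by rewrite cev_coboundary_cup f0 g0 !cev0 mul0r !mulr0 addr0 mulr0.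
Qed.

Fact bcocycle_cup_subproof p q (f : bcocycle p) (g : bcocycle q) :
  cochain_cup f g \in @bcocycle_pred (p + q).
Proof.
apply/eqP; apply: cochain_cup_bcocycle; exact: bcocycle_coboundary.
Qed.

Lemma cast_bcoboundary n (f : bcochain n) m (h : bcochain m) :
  m.+1 = n -> cev f =1 cev (coboundary h) -> is_bcoboundary f.
Proof. by move=> mn; subst n => /cev_inj fh; exists h. Qed.

Lemma bcoboundary0 n : is_bcoboundary (0 : bcochain n).
Proof. by case: n => [|n] //=; exists 0; rewrite [RHS]linear0. Qed.

Lemma cup_bcoboundaryl p q (f : bcochain p) (g : bcochain q) :
  is_bcoboundary f -> coboundary g = 0 -> is_bcoboundary (cochain_cup f g).
Proof.
case: p f => [|p] f.
  move=> -> _; have -> : cochain_cup (0 : bcochain 0) g = 0; last first.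
    exact: bcoboundary0.
  by apply: cev_inj => u; rewrite cev_cup cev0 mul0r mulr0.
move=> [h ->] g0.
apply: (@cast_bcoboundary _ _ _ ((-1) ^+ q *: cochain_cup h g)) => // u.
have -> : coboundary ((-1) ^+ q *: cochain_cup h g) =
          (-1) ^+ q *: coboundary (cochain_cup h g) by rewrite [LHS]linearZ.
rewrite cevZ cev_coboundary_cup cev_cup g0 cev0.
by rewrite !mulr0 addr0 mulSn exprD -[LHS]mulrA.
Qed.

Lemma cup_bcoboundaryr p q (f : bcochain p) (g : bcochain q) :
  coboundary f = 0 -> is_bcoboundary g -> is_bcoboundary (cochain_cup f g).
Proof.
move=> f0; case: q g => [|q] g.
  move=> ->; have -> : cochain_cup f (0 : bcochain 0) = 0; last first.
    exact: bcoboundary0.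
  by apply: cev_inj => u; rewrite cev_cup cev0 !mulr0.
move=> [h ->].
apply: (@cast_bcoboundary _ _ _ (cochain_cup f h)) => [|u].
  by rewrite addnS.
rewrite cev_coboundary_cup cev_cup f0 cev0 mul0r add0r mulrA -exprD.
by rewrite mulnS addnC.
Qed.

Definition bcocycle_cup p q (f : bcocycle p) (g : bcocycle q) :
  bcocycle (p + q) := Bcocycle (bcocycle_cup_subproof f g).

(* Defined on chosen representatives; [Hb_cup_class] gives independence. *)
Definition Hb_cup p q (x : Hb p) (y : Hb q) : Hb (p + q) :=
  Hb_class (bcocycle_cup (lquot_repr x) (lquot_repr y)).

Lemma Hb_cup_class p q (f : bcocycle p) (g : bcocycle q) :
  Hb_cup (Hb_class f) (Hb_class g) = Hb_class (bcocycle_cup f g).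
Proof.
rewrite /Hb_cup; set f' := lquot_repr _; set g' := lquot_repr _.
have /asboolP fB : f' - f \in @bcoboundary_pred p.
  by apply/lquot_piP; rewrite lquot_reprK.
have /asboolP gB : g' - g \in @bcoboundary_pred q.
  by apply/lquot_piP; rewrite lquot_reprK.
transitivity (Hb_class (bcocycle_cup f g')); apply/lquot_piP/asboolP.
  have -> : bcocycle_val (bcocycle_cup f' g' - bcocycle_cup f g') =
            cochain_cup (bcocycle_val (f' - f)) g'.
    apply: cev_inj => u; rewrite cev_cup [in RHS]cevB mulrBl mulrBr.
    by rewrite [LHS]cevB !cev_cup.
  by apply: cup_bcoboundaryl => //; apply: bcocycle_coboundary.
have -> : bcocycle_val (bcocycle_cup f g' - bcocycle_cup f g) =
          cochain_cup f (bcocycle_val (g' - g)).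
  apply: cev_inj => u; rewrite cev_cup [in RHS]cevB mulrBr mulrBr.
  by rewrite [LHS]cevB !cev_cup.
by apply: cup_bcoboundaryr => //; apply: bcocycle_coboundary.
Qed.

Definition unit_functional : chain 0 -> R^o := chain_lift (fun=> 1 : R^o).
HB.instance Definition _ := GRing.Linear.on unit_functional.
Fact unit_functional_subproof :
  (unit_functional : chain 0 -> R^o) \in @bounded_functional 0.
Proof.
apply/(bounded_functionalP unit_functional); exists 1 => t /=.
by rewrite [unit_functional _]chain_lift_simplex normr1.
Qed.
Definition unit_bcochain : bcochain 0 := Bcochain unit_functional_subproof.
Fact unit_bcochain_subproof : unit_bcochain \in @bcocycle_pred 0.
Proof.
apply/eqP/val_inj/funext => c /=.
rewrite [c]chain_sumE !linear_sum big1 // => t _.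
rewrite !linearZ /= [boundary _]chain_lift_simplex linear_sum /=.
rewrite !big_ord_recl big_ord0 /= !linearZ /=.
rewrite ![unit_functional _]chain_lift_simplex /= expr0 expr1.
by rewrite scale1r scaleN1r addr0 subrr scaler0.
Qed.
Definition Hb_one : Hb 0 := Hb_class (Bcocycle unit_bcochain_subproof).

(* phi 0 \cup (phi 1 \cup ( ... (phi (n - 1) \cup 1))). The degree is written
   [n * 2] because [n.+1 * 2] and [2 + n * 2] are convertible. *)
Fixpoint Hb_cups (n : nat) (phi : nat -> Hb 2) : Hb (n * 2) :=
  match n with
  | 0 => Hb_one
  | m.+1 => Hb_cup (phi 0%N) (Hb_cups m (fun i => phi i.+1))
  end.

Local Open Scope classical_set_scope.
(* Degree 0 always contributes (its cohomology is the line of constants), so the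
   supremum lies in {0, 1, 2, ...} together with +oo. *)
Definition bcd : \bar R :=
  ereal_sup [set (n%:R)%:E | n in [set n : nat | exists x : Hb n, x != 0]].

End BoundedCohomology.

Section Products.
Variable Gs : nat -> groupType.
Local Open Scope group_scope.

Definition gprod : Type := forall n, Gs n.
HB.instance Definition _ := Choice.on gprod.

Definition gprod_one : gprod := fun n => 1.
Definition gprod_inv (x : gprod) : gprod := fun n => (x n)^-1.
Definition gprod_mul (x y : gprod) : gprod := fun n => x n * y n.
Fact gprod_mulA : associative gprod_mul.
Proof.
by move=> x y z; apply: functional_extensionality_dep => n; exact: mulgA.
Qed.
Fact gprod_mul1g : left_id gprod_one gprod_mul.
Proof.
by move=> x; apply: functional_extensionality_dep => n; exact: mul1g.
Qed.
Fact gprod_mulg1 : right_id gprod_one gprod_mul.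
Proof.
by move=> x; apply: functional_extensionality_dep => n; exact: mulg1.
Qed.
Fact gprod_mulVg : left_inverse gprod_one gprod_inv gprod_mul.
Proof.
by move=> x; apply: functional_extensionality_dep => n; exact: mulVg.
Qed.
Fact gprod_mulgV : right_inverse gprod_one gprod_inv gprod_mul.
Proof.
by move=> x; apply: functional_extensionality_dep => n; exact: mulgV.
Qed.
HB.instance Definition _ := isGroup.Build gprod
  gprod_mulA gprod_mul1g gprod_mulg1 gprod_mulVg gprod_mulgV.

Definition finite_support : {pred gprod} :=
  [pred x : gprod | `[< finite_set [set n | x n != 1] >]].

Record gsum := Gsum { gsum_val :> gprod ; _ : gsum_val \in finite_support }.
HB.instance Definition _ := [isSub for gsum_val].
HB.instance Definition _ := [Choice of gsum by <:].
Fact finite_support_closed : group_closed finite_support.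
Proof.
split=> [|x y /asboolP fx /asboolP fy]; apply/asboolP.
  apply: (@sub_finite_set _ _ set0) => [n /=|]; last exact: finite_set0.
  by rewrite eqxx.
apply: (@sub_finite_set _ _
    ([set n | x n != 1] `|` [set n | y n != 1])%classic).
  move=> n /= xy; apply/or_asboolP/negPn/negP; rewrite !asboolb => /norP[].
  move=> /negPn/eqP x1 /negPn/eqP y1; case/eqP: xy.
  by rewrite -[LHS]/(x n * (y n)^-1) x1 y1 mulgV.
by rewrite finite_setU.
Qed.
HB.instance Definition _ :=
  SubChoice_isSubGroup.Build gprod finite_support gsum finite_support_closed.

Definition direct_product : groupType := gprod.
Definition direct_sum : groupType := gsum.

End Products.

(* Main.v *)
From HB Require Import structures.
From mathcomp Require Import topology normedtype sequences.
From mathcomp Require Import zify ring lra.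
Require Import Defs.
From mathcomp Require Import all_boot all_order all_algebra.
From mathcomp Require Import boolp classical_sets cardinality reals ereal.
Import GRing.Theory.
Local Open Scope ring_scope.
Set Implicit Arguments.
Unset Strict Implicit.
Unset Printing Implicit Defensive.
Import Order.TTheory Num.Theory numFieldNormedType.Exports.

(**
In degree 2, bounded classes are detected by explicit l^1-cycles, and a cup
product can be shortened by taking slant products with such cycles.

The cycles.  The boundary of (x, x) is 2 (x) - (x^2), so the boundary of the
l^1-chain s(x) = sum_k 2^-(k+1) (x^(2^k), x^(2^k)), of norm 1, telescopes to
(x).  Consequently every pair (a, b) completes to the l^1-cycle
z(a, b) = (a, b) - s(b) + s(ab) - s(a).

Detection in degree 2.  Subtracting from a bounded cocycle f the coboundary of
its pairing with s gives a cohomologous bounded cocycle e whose value at (a, b)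
is the pairing of f with z(a, b).  If all these values vanish, then f is the
coboundary of a bounded function.  A nonzero class is thus represented by some
e with e(a, b) <> 0 for some pair, e(g, g) = 0 for all g, and hence
e(1, g) = e(g, 1) = 0 ([homogenized_cocycle], [cocycle2_unit]).

Cancellation of a factor.  Let a, b commute with every element of a subgroup D.
The slant product by the cycle z(a, b), a signed sum over shuffles, sends
bounded cochains of degree n + 2 to bounded cochains of degree n on D and
commutes with the coboundary ([cobd_cycle_slant]).  If e vanishes whenever one
argument lies in D, only one shuffle contributes to the slant product of
e \cup psi by z(a, b), and the result is e(a, b) psi ([cycle_slant_cup2]).  So
if e \cup psi is a bounded coboundary, then so is psi on D ([cobounds_cup2]).

The n-th factor G_n is a retract of the sum and of the product, and it commutes
with all elements of trivial n-th coordinate.  Let phi_n be the pull-back of a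
nonzero class of G_n.  If phi_0 \cup ... \cup phi_(n-1) vanished, cancelling
phi_0, phi_1, ... in turn, each time restricting to the elements whose next
coordinate is trivial too, would show that the unit class in degree 0 vanishes
([word_cups_not_cobounds]).
*)

(** * Dyadic means of bounded sequences *)

Section DyadicMean.
Local Open Scope classical_set_scope.
Variable R : realType.
Implicit Types u v : nat -> R.

Definition bounded_seq u := exists M, forall k, `|u k| <= M.

Definition dyadic_mean u : R :=
  limn (series (fun k => 2^-1 ^+ k.+1 * u k)).

Lemma half_lt1 : `|2^-1 : R| < 1.
Proof. by rewrite ger0_norm ?invr_ge0 ?ler0n // invf_lt1 ?ltr0n ?ltr1n. Qed.

Lemma series_dyadic1 : series (fun k => 2^-1 ^+ k.+1 : R) @ \oo --> (1 : R).
Proof.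
have -> : (fun k => 2^-1 ^+ k.+1 : R) = geometric 2^-1 2^-1.
  by apply: funext => k; rewrite exprS.
have := @cvg_geometric_series R 2^-1 2^-1 half_lt1.
by have -> : 2^-1 / (1 - 2^-1) = 1 :> R by field.
Qed.

Lemma normed_dyadic u M : (forall k, `|u k| <= M) ->
  forall k, `|2^-1 ^+ k.+1 * u k| <= M * 2^-1 ^+ k.+1.
Proof.
move=> uM k; rewrite normrM [X in X * _]ger0_norm ?exprn_ge0 ?invr_ge0 ?ler0n//.
by rewrite mulrC ler_wpM2r // exprn_ge0 ?invr_ge0 ?ler0n.
Qed.

Lemma is_cvg_dyadic_bound M : cvgn (series (fun k => M * 2^-1 ^+ k.+1 : R)).
Proof.
have c1 : cvgn (series (fun k => 2^-1 ^+ k.+1 : R^o)).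
  by apply/cvg_ex; exists 1; exact: series_dyadic1.
exact (@is_cvg_seriesZ R _ M c1).
Qed.

Lemma is_cvg_normed_dyadic u : bounded_seq u ->
  cvgn [normed series (fun k => 2^-1 ^+ k.+1 * u k)].
Proof.
move=> [M uM]; apply: series_le_cvg (normed_dyadic uM) _ => //.
  by move=> k; rewrite (le_trans _ (normed_dyadic uM k)).
exact: is_cvg_dyadic_bound.
Qed.

Lemma is_cvg_dyadic u : bounded_seq u ->
  cvgn (series (fun k => 2^-1 ^+ k.+1 * u k)).
Proof. by move/is_cvg_normed_dyadic/normed_cvg. Qed.

Lemma dyadic_mean_lin c u v : bounded_seq u -> bounded_seq v ->
  dyadic_mean (fun k => c * u k + v k) = c * dyadic_mean u + dyadic_mean v.
Proof.
move=> /is_cvg_dyadic cu /is_cvg_dyadic cv; rewrite /dyadic_mean.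
pose f k : R := 2^-1 ^+ k.+1 * u k; pose g k : R := 2^-1 ^+ k.+1 * v k.
transitivity (limn (series (fun k => c * f k)) + limn (series g)).
  rewrite -lim_seriesD //; last exact (@is_cvg_seriesZ R f c cu).
  congr (limn (series _)); apply: funext => k.
  by rewrite mulrDr mulrCA.
by congr (_ + _); exact (@lim_seriesZ R f c cu).
Qed.

Lemma dyadic_mean_le u M : (forall k, `|u k| <= M) -> `|dyadic_mean u| <= M.
Proof.
move=> uM; have bu : bounded_seq u by exists M.
apply: le_trans (lim_series_norm (is_cvg_normed_dyadic bu)) _.
have := @lim_series_le R _ _ (is_cvg_normed_dyadic bu) (@is_cvg_dyadic_bound M)
  (normed_dyadic uM).
move=> /le_trans; apply.
have c1 : cvgn (series (fun k => 2^-1 ^+ k.+1 : R)).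
  by apply/cvg_ex; exists 1; exact: series_dyadic1.
have -> : limn (series (fun k => M * 2^-1 ^+ k.+1 : R)) =
    M * limn (series (fun k => 2^-1 ^+ k.+1 : R)).
  exact (@lim_seriesZ R _ M c1).
by rewrite (cvg_lim _ series_dyadic1) // mulr1.
Qed.

Lemma bounded_shift u : bounded_seq u -> bounded_seq (fun k => u k.+1).
Proof. by case=> M uM; exists M. Qed.

(** This identity is what makes the boundary of the chain
    sum_k 2^-(k+1) (g^(2^k), g^(2^k)) telescope to (g). *)
Lemma dyadic_mean_shift u : bounded_seq u ->
  dyadic_mean u = 2^-1 * (u 0%N + dyadic_mean (fun k => u k.+1)).
Proof.
move=> bu; have cu := is_cvg_dyadic (bounded_shift bu).
apply: cvg_lim => //; rewrite -cvg_shiftS /=.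
have -> : (fun n => series (fun k => 2^-1 ^+ k.+1 * u k) n.+1) =
    (fun n => 2^-1 * (u 0%N + series (fun k => 2^-1 ^+ k.+1 * u k.+1) n)).
  apply: funext => n; rewrite /series /= big_nat_recl // expr1 mulrDr.
  rewrite mulr_sumr; congr (_ + _); apply: eq_bigr => i _.
  by rewrite exprS mulrA.
by apply: cvgMr; apply: cvgD => //; apply: cvg_cst.
Qed.

Lemma bounded_seq_lin c u v : bounded_seq u -> bounded_seq v ->
  bounded_seq (fun k => c * u k + v k).
Proof.
move=> [M uM] [N vN]; exists (`|c| * M + N) => k.
by rewrite (le_trans (ler_normD _ _)) // lerD // normrM ler_wpM2l.
Qed.

Lemma bounded_seq_cst c : bounded_seq (fun=> c : R).
Proof. by exists `|c|. Qed.

Lemma dyadic_mean0 : dyadic_mean (fun=> 0 : R) = 0.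
Proof.
apply/eqP; rewrite -normr_le0.
by apply: dyadic_mean_le => k; rewrite normr0.
Qed.

End DyadicMean.

(** * Slant products of cochains by commuting elements *)

Section ListCochains.
Variables (R : realType) (G : groupType).
Implicit Types (F H : seq G -> R) (a b g x y : G) (l : seq G).

(** An inhomogeneous cochain is encoded as a function on words of any length,
    its degree being the length it is applied to: with no degree casts, fixing
    the first letter turns [F] into a cochain [F \o cons x] of one degree less,
    and inductions can run over the word.  The recursion merges or deletes the
    first letter and leaves the later faces to [F \o cons x]; [cobdE] recovers
    the usual alternating sum.  On words of length 1 the two faces are both the
    empty word and cancel. *)
Fixpoint cobd F l : R :=
  if l is x :: l' then
    if l' is y :: l'' then
      F l' - F ((x * y)%g :: l'') + F (x :: l'') - cobd (F \o cons x) l'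
    else 0
  else 0.

Lemma cobd_cons2 F x y l :
  cobd F (x :: y :: l) = F (y :: l) - F ((x * y)%g :: l) + F (x :: l)
    - cobd (F \o cons x) (y :: l).
Proof. by []. Qed.

Lemma cobd_lin c F H l :
  cobd (fun m => c * F m + H m) l = c * cobd F l + cobd H l.
Proof.
elim: l F H => [|x [|y l] IH] F H; rewrite ?mulr0 ?addr0 //.
rewrite !cobd_cons2 (IH (F \o cons x) (H \o cons x)); ring.
Qed.

(** The slant products by (g) and by (a, b): the sum of the values of [F] on all
    shuffles of (g), respectively (a, b), with the word [l], with the sign of
    the shuffle.  The recursion distinguishes whether the first letter of the
    shuffle comes from the chain or from [l]; passing a letter of [l] across the
    two letters a, b costs no sign. *)
Fixpoint slant1 g F l : R :=
  if l is x :: l' then F (g :: l) - slant1 g (F \o cons x) l' else F [:: g].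

Fixpoint slant2 a b F l : R :=
  if l is x :: l' then slant1 b (F \o cons a) l + slant2 a b (F \o cons x) l'
  else F [:: a; b].

Lemma slant1_lin c g F H l :
  slant1 g (fun m => c * F m + H m) l = c * slant1 g F l + slant1 g H l.
Proof.
elim: l F H => [|x l IH] F H //=.
rewrite (IH (F \o cons x) (H \o cons x)); ring.
Qed.

Lemma slant2_lin c a b F H l :
  slant2 a b (fun m => c * F m + H m) l = c * slant2 a b F l + slant2 a b H l.
Proof.
elim: l F H => [|x l IH] F H //=.
rewrite (IH (F \o cons x) (H \o cons x)).
rewrite (slant1_lin c b (F \o cons a \o cons x) (H \o cons a \o cons x)); ring.
Qed.

(** The recursive formula for [cobd] is linear, so slant products distribute
    over it. *)
Lemma slant1_cobd g F x y l :
  slant1 g (cobd F \o cons x \o cons y) l =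
    slant1 g (F \o cons y) l - slant1 g (F \o cons (x * y)%g) l
    + slant1 g (F \o cons x) l - slant1 g (cobd (F \o cons x) \o cons y) l.
Proof.
transitivity (slant1 g (fun m => -1 * (F \o cons (x * y)%g) m +
   (fun m => -1 * (cobd (F \o cons x) \o cons y) m +
     (fun m => 1 * (F \o cons y) m + (F \o cons x) m) m) m) l).
  by congr (slant1 g _ l); apply: funext => m /=; ring.
rewrite !slant1_lin; ring.
Qed.

Lemma slant2_cobd a b F x y l :
  slant2 a b (cobd F \o cons x \o cons y) l =
    slant2 a b (F \o cons y) l - slant2 a b (F \o cons (x * y)%g) l
    + slant2 a b (F \o cons x) l - slant2 a b (cobd (F \o cons x) \o cons y) l.
Proof.
transitivity (slant2 a b (fun m => -1 * (F \o cons (x * y)%g) m +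
   (fun m => -1 * (cobd (F \o cons x) \o cons y) m +
     (fun m => 1 * (F \o cons y) m + (F \o cons x) m) m) m) l).
  by congr (slant2 a b _ l); apply: funext => m /=; ring.
rewrite !slant2_lin; ring.
Qed.

Definition commutes_with g l := {in l, forall x, (g * x)%g = (x * g)%g}.

Lemma commutes_with_cons g x l : commutes_with g (x :: l) ->
  (g * x)%g = (x * g)%g /\ commutes_with g l.
Proof.
move=> cl; split; first by apply: cl; rewrite inE eqxx.
by move=> y yl; apply: cl; rewrite inE yl orbT.
Qed.

(** The chain (g) has boundary zero.  The faces that merge [g] with a letter on
    its right cancel against those that merge it with the same letter on its
    left, because the two commute. *)
Lemma cobd_slant1 g F l : commutes_with g l ->
  cobd (slant1 g F) l = - slant1 g (cobd F) l.
Proof.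
elim: l F => [|x [|y l] IH] F.
- by rewrite /= oppr0.
- move=> /commutes_with_cons[gx _] /=; rewrite gx; ring.
- move=> /commutes_with_cons[gx cl].
have IHx := IH (F \o cons x) cl.
rewrite cobd_cons2.
have -> : cobd (slant1 g F \o cons x) (y :: l) =
   cobd (F \o cons g \o cons x) (y :: l)
   - cobd (slant1 g (F \o cons x)) (y :: l).
  transitivity (cobd (fun m => -1 * slant1 g (F \o cons x) m +
    (F \o cons g \o cons x) m) (y :: l)).
    by congr (cobd _ _); apply: funext => m /=; ring.
  by rewrite cobd_lin; ring.
have -> : slant1 g (cobd F) [:: x, y & l] = cobd F [:: g, x, y & l] -
    (cobd F [:: x, g, y & l] - slant1 g (cobd F \o cons x \o cons y) l) by [].
rewrite IHx slant1_cobd /= gx; ring.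
Qed.

(** The correction term is the slant product by (b) - (ab) + (a), the boundary
    of (a, b).  As above, the faces merging [a] or [b] with a letter of [l]
    cancel in pairs. *)
Lemma cobd_slant2 a b F l : commutes_with a l -> commutes_with b l ->
  cobd (slant2 a b F) l = slant2 a b (cobd F) l
    - (slant1 b F l - slant1 (a * b)%g F l + slant1 a F l).
Proof.
elim: l F => [|x [|y l] IH] F.
- by move=> _ _ /=; ring.
- move=> /commutes_with_cons[ax _] /commutes_with_cons[bx _] /=.
  rewrite ax bx; ring.
- move=> /commutes_with_cons[ax cal] /commutes_with_cons[bx cbl].
have IHx := IH (F \o cons x) cal cbl.
have I1 := cobd_slant1 (F \o cons a \o cons x) cbl.
rewrite cobd_cons2.
have -> : cobd (slant2 a b F \o cons x) (y :: l) =
   cobd (F \o cons a \o cons b \o cons x) (y :: l)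
   - cobd (slant1 b (F \o cons a \o cons x)) (y :: l)
   + cobd (slant2 a b (F \o cons x)) (y :: l).
  transitivity (cobd (fun m => -1 * slant1 b (F \o cons a \o cons x) m +
    (fun m => 1 * slant2 a b (F \o cons x) m +
    (F \o cons a \o cons b \o cons x) m) m) (y :: l)).
    by congr (cobd _ _); apply: funext => m /=; ring.
  by rewrite !cobd_lin; ring.
have -> : slant2 a b (cobd F) [:: x, y & l] =
    cobd F [:: a, b, x, y & l] - slant1 b (cobd F \o cons a \o cons x) (y :: l)
    + slant1 b (cobd F \o cons x \o cons a) (y :: l)
    + slant2 a b (cobd F \o cons x \o cons y) l by rewrite -addrA.
rewrite IHx I1 !slant1_cobd slant2_cobd /= ax bx.
rewrite (slant1_cobd b (F \o cons a)); ring.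
Qed.

End ListCochains.

(** * The slant product by an l^1-cycle in degree 2 *)

Section Slant.
Variables (R : realType) (G : groupType).
Implicit Types (F H : seq G -> R) (a b g x y : G) (l : seq G).

(** Boundedness in each degree separately: the number of shuffles, and with it
    the norm of a slant product, grows with the degree. *)
Definition deg_bounded F :=
  forall n, exists M, forall l, size l = n -> `|F l| <= M.

Lemma deg_bounded_lin c F H : deg_bounded F -> deg_bounded H ->
  deg_bounded (fun l => c * F l + H l).
Proof.
move=> bF bH n; have [M FM] := bF n; have [N HN] := bH n.
exists (`|c| * M + N) => l ln.
rewrite (le_trans (ler_normD _ _)) // lerD ?HN // normrM ler_wpM2l //.
exact: FM.
Qed.

Lemma slant1_le g F l M : (forall m, size m = (size l).+1 -> `|F m| <= M) ->
  `|slant1 g F l| <= (size l).+1%:R * M.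
Proof.
elim: l F => [|x l IH] F FM; first by rewrite mul1r FM.
rewrite -natr1 mulrDl mul1r addrC (le_trans (ler_normB _ _)) // lerD ?FM //.
by apply: IH => m ml; apply: FM; rewrite /= ml.
Qed.

Lemma slant2_le a b F l M : (forall m, size m = (size l).+2 -> `|F m| <= M) ->
  `|slant2 a b F l| <= ((size l).+1 ^ 2)%:R * M.
Proof.
elim: l F => [|x l IH] F FM; first by rewrite mul1r FM.
have M0 : 0 <= M.
  by apply: le_trans (FM (nseq (size l).+3 1%g) _); rewrite ?size_nseq.
have I1 : `|slant1 b (F \o cons a) (x :: l)| <= (size l).+2%:R * M.
  by apply: slant1_le => m ml; apply: FM; rewrite /= ml.
have I2 : `|slant2 a b (F \o cons x) l| <= ((size l).+1 ^ 2)%:R * M.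
  by apply: IH => m ml; apply: FM; rewrite /= ml.
apply: le_trans (ler_normD _ _) _; apply: le_trans (lerD I1 I2) _.
rewrite -mulrDl -natrD ler_wpM2r // ler_nat /=.
by rewrite !expnS expn0 !muln1; move: (size l) => n; nia.
Qed.

(** The slant product by s(g) = sum_k 2^-(k+1) (g^(2^k), g^(2^k)), an l^1-chain
    with boundary (g). *)
Definition dyadic_slant g F l : R :=
  dyadic_mean (fun k => slant2 (g ^+ (2 ^ k))%g (g ^+ (2 ^ k))%g F l).

(** The slant product by the l^1-cycle (a, b) - s(b) + s(ab) - s(a). *)
Definition cycle_slant a b F l : R :=
  slant2 a b F l
    - dyadic_slant b F l + dyadic_slant (a * b)%g F l - dyadic_slant a F l.

Lemma bounded_seq_slant1 (g : nat -> G) F l : deg_bounded F ->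
  bounded_seq (fun k => slant1 (g k) F l).
Proof.
move=> bF; have [M FM] := bF (size l).+1.
by exists ((size l).+1%:R * M) => k; apply: slant1_le.
Qed.

Lemma bounded_seq_slant2 (a b : nat -> G) F l : deg_bounded F ->
  bounded_seq (fun k => slant2 (a k) (b k) F l).
Proof.
move=> bF; have [M FM] := bF (size l).+2.
by exists (((size l).+1 ^ 2)%:R * M) => k; apply: slant2_le.
Qed.

(** A coboundary is pointwise a finite combination of values, so it can be taken
    under the mean.  Boundedness of the resulting sequence is proved together
    with the equality since the linearity used in the induction requires it. *)
Lemma cobd_dyadic_mean (F : nat -> seq G -> R) l :
  (forall m, bounded_seq (F ^~ m)) ->
  bounded_seq (fun k => cobd (F k) l) /\
  cobd (fun m => dyadic_mean (F ^~ m)) l = dyadic_mean (fun k => cobd (F k) l).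
Proof.
move=> bF; elim: l F bF => [|x [|y l] IH] F bF.
- by rewrite dyadic_mean0; split=> //; apply: bounded_seq_cst.
- by rewrite dyadic_mean0; split=> //; apply: bounded_seq_cst.
- have [b0 e0] := IH (fun k => F k \o cons x) (fun m => bF (x :: m)).
have -> : (fun k => cobd (F k) [:: x, y & l]) =
  (fun k => -1 * cobd (F k \o cons x) (y :: l) + (fun k =>
     -1 * F k ((x * y)%g :: l) + (fun k =>
      1 * F k (y :: l) + F k (x :: l)) k) k).
  by apply: funext => k; rewrite cobd_cons2; ring.
have b1 : bounded_seq (fun k => 1 * F k (y :: l) + F k (x :: l)).
  exact: bounded_seq_lin.
have b2 : bounded_seq (fun k => -1 * F k ((x * y)%g :: l) + (fun k =>
      1 * F k (y :: l) + F k (x :: l)) k) by exact: bounded_seq_lin.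
split; first exact: bounded_seq_lin.
rewrite (dyadic_mean_lin _ b0 b2) (dyadic_mean_lin _ _ b1) //.
rewrite dyadic_mean_lin //.
by rewrite cobd_cons2 e0; ring.
Qed.

Lemma commutes_withX g n l : commutes_with g l -> commutes_with (g ^+ n)%g l.
Proof.
by move=> cl x /cl gx; apply: commute_sym; apply: commuteX; apply: commute_sym.
Qed.

Lemma commutes_withM a b l : commutes_with a l -> commutes_with b l ->
  commutes_with (a * b)%g l.
Proof.
move=> ca cb x xl; apply: commute_sym; apply: commuteM; apply: commute_sym.
  exact: ca.
exact: cb.
Qed.

Lemma expg_pow2S g k : (g ^+ (2 ^ k.+1) = g ^+ (2 ^ k) * g ^+ (2 ^ k))%g.
Proof. by rewrite expnSr expgnA expg2. Qed.

(** The boundary of (g^(2^k), g^(2^k)) is 2 (g^(2^k)) - (g^(2^(k+1))), and these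
    terms, weighted by 2^-(k+1), telescope to (g). *)
Lemma cobd_dyadic_slant g H l : deg_bounded H -> commutes_with g l ->
  cobd (dyadic_slant g H) l = dyadic_slant g (cobd H) l - slant1 g H l.
Proof.
move=> bH cl; pose gk k := (g ^+ (2 ^ k))%g.
have bslant1 : bounded_seq (fun k => slant1 (gk k) H l).
  exact: bounded_seq_slant1.
have [b0 e0] : bounded_seq (fun k => cobd (slant2 (gk k) (gk k) H) l) /\
  cobd (dyadic_slant g H) l =
    dyadic_mean (fun k => cobd (slant2 (gk k) (gk k) H) l).
  by apply: cobd_dyadic_mean => m; apply: bounded_seq_slant2.
have bS := bounded_shift bslant1.
have bS1 : bounded_seq (fun k => -1 * slant1 (gk k.+1) H l +
    cobd (slant2 (gk k) (gk k) H) l) by apply: bounded_seq_lin.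
rewrite e0 /dyadic_slant.
have -> : (fun k => slant2 (g ^+ (2 ^ k))%g (g ^+ (2 ^ k))%g (cobd H) l) =
  (fun k => 2 * slant1 (gk k) H l +
    (fun k => -1 * slant1 (gk k.+1) H l + cobd (slant2 (gk k) (gk k) H) l) k).
  apply: funext => k; rewrite cobd_slant2; try exact: commutes_withX.
  by rewrite /gk -expg_pow2S; ring.
rewrite (dyadic_mean_lin _ bslant1 bS1) (dyadic_mean_lin _ bS b0).
rewrite [X in 2 * X](dyadic_mean_shift bslant1) /gk expn0 expg1.
by field.
Qed.

(** The boundary terms (b) - (ab) + (a) of (a, b) are cancelled by those of the
    three dyadic chains. *)
Lemma cobd_cycle_slant a b H l : deg_bounded H ->
  commutes_with a l -> commutes_with b l ->
  cobd (cycle_slant a b H) l = cycle_slant a b (cobd H) l.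
Proof.
move=> bH ca cb; have cab := commutes_withM ca cb.
have -> : cycle_slant a b H = (fun m => -1 * dyadic_slant a H m + (fun m =>
    -1 * dyadic_slant b H m + (fun m =>
      1 * dyadic_slant (a * b)%g H m + slant2 a b H m) m) m).
  by apply: funext => m; rewrite /cycle_slant; ring.
rewrite !cobd_lin !cobd_dyadic_slant // cobd_slant2 // /cycle_slant; ring.
Qed.

Lemma cycle_slant_bounded a b F :
  deg_bounded F -> deg_bounded (cycle_slant a b F).
Proof.
move=> bF n; have [M FM] := bF n.+2.
set C := (n.+1 ^ 2)%:R * M.
have i2 g h l : size l = n -> `|slant2 g h F l| <= C.
  by move=> ln; rewrite /C -ln; apply: slant2_le => m; rewrite ln; apply: FM.
have ds g l : size l = n -> `|dyadic_slant g F l| <= C.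
  by move=> ln; apply: dyadic_mean_le => k; apply: i2.
exists (C + C + C + C) => l ln; rewrite /cycle_slant.
rewrite (le_trans (ler_normB _ _)) // lerD ?ds //.
rewrite (le_trans (ler_normD _ _)) // lerD ?ds //.
by rewrite (le_trans (ler_normB _ _)) // lerD ?ds ?i2.
Qed.

Variables (K : pred G).
Hypothesis K1 : K 1%g.
Hypothesis KM : forall x y, K x -> K y -> K (x * y)%g.

Lemma eq_slant1 g F H l : K g -> all K l ->
  (forall m, size m = (size l).+1 -> all K m -> F m = H m) ->
  slant1 g F l = slant1 g H l.
Proof.
move=> Kg; elim: l F H => [|x l IH] F H /=.
  by move=> _ FH; apply: FH => //=; rewrite Kg.
move=> /andP[Kx Kl] FH; congr (_ - _); first by apply: FH; rewrite /= ?Kg ?Kx.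
by apply: IH => // m ml Km; apply: FH => /=; rewrite ?ml ?Kx.
Qed.

Lemma eq_slant2 a b F H l : K a -> K b -> all K l ->
  (forall m, size m = (size l).+2 -> all K m -> F m = H m) ->
  slant2 a b F l = slant2 a b H l.
Proof.
move=> Ka Kb; elim: l F H => [|x l IH] F H.
  by move=> _ FH; apply: FH => //=; rewrite Ka Kb.
move=> /= /andP[Kx Kl] FH.
rewrite [LHS]/= [RHS]/=; congr (_ + _).
  apply: (@eq_slant1 b (F \o cons a) (H \o cons a) (x :: l)) => //=.
    by rewrite Kx.
  by move=> m ml Km; apply: FH; rewrite /= ?ml ?Ka.
by apply: IH => // m ml Km; apply: FH => /=; rewrite ?ml ?Kx.
Qed.

Lemma Kexp g n : K g -> K (g ^+ n)%g.
Proof. by move=> Kg; elim: n => // n IH; rewrite expgS KM. Qed.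

(** The cycle has entries in the submonoid generated by [a] and [b], so its
    shuffles with words in [K] are words in [K]. *)
Lemma eq_cycle_slant a b F H l : K a -> K b -> all K l ->
  (forall m, size m = (size l).+2 -> all K m -> F m = H m) ->
  cycle_slant a b F l = cycle_slant a b H l.
Proof.
move=> Ka Kb Kl FH; have Kab := KM Ka Kb.
have ds g : K g -> dyadic_slant g F l = dyadic_slant g H l.
  move=> Kg; congr dyadic_mean; apply: funext => k.
  by apply: eq_slant2 => //; apply: Kexp.
by rewrite /cycle_slant !ds // (@eq_slant2 a b F H).
Qed.

(** The cup product of a 2-cochain with [F]; the sign (-1)^(2q) is 1. *)
Definition cup2 (e : G -> G -> R) F l : R :=
  if l is x :: y :: m then e x y * F m else 0.

Lemma slant1_0 g l : slant1 g (fun=> 0) l = 0 :> R.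
Proof. by elim: l => //= x l IH; rewrite [slant1 _ _ _]IH subr0. Qed.

Lemma slant2_0 a b l : slant2 a b (fun=> 0) l = 0 :> R.
Proof.
elim: l => //= x l IH.
by rewrite [slant1 _ _ _]slant1_0 [slant2 _ _ _ _]IH subrr addr0.
Qed.

(** Every shuffle except (a, b, l) puts a letter of [l] into one of the first two
    places, where [e] kills it. *)
Lemma slant2_cup2 (e : G -> G -> R) F a b l :
  {in l, forall x y, e x y = 0 /\ e y x = 0} ->
  slant2 a b (cup2 e F) l = e a b * F l.
Proof.
case: l => [//|x l] le0 /=.
have ex y := le0 x (mem_head _ _) y.
have -> : (cup2 e F \o cons a) \o cons x = fun=> 0.
  by apply: funext => m /=; rewrite (ex a).2 mul0r.
have -> : cup2 e F \o cons x = fun=> 0.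
  by apply: funext => -[|y m] //=; rewrite (ex y).1 mul0r.
by rewrite slant1_0 slant2_0 subr0 addr0.
Qed.

(** Since [e] vanishes on the diagonal, it does not see the dyadic chains. *)
Lemma cycle_slant_cup2 (e : G -> G -> R) F a b l :
  (forall g, e g g = 0) ->
  {in l, forall x y, e x y = 0 /\ e y x = 0} ->
  cycle_slant a b (cup2 e F) l = e a b * F l.
Proof.
move=> e0 le0; have ds g : dyadic_slant g (cup2 e F) l = 0.
  rewrite -[RHS](@dyadic_mean0 R); congr dyadic_mean; apply: funext => k.
  by rewrite slant2_cup2 // e0 mul0r.
by rewrite /cycle_slant !ds slant2_cup2 // !subr0 addr0.
Qed.

(** Restricting the words to letters in [D] stands for pulling the cochain back
    to the subgroup [D]; the primitive may be defined on all words. *)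
Definition cobounds_on (D : pred G) n F :=
  exists2 H, deg_bounded H & forall l, size l = n -> all D l -> F l = cobd H l.

(** Cancellation of a degree-2 factor: the slant product by the cycle of (a, b)
    turns a primitive of the cup product into [e a b] times a primitive of [F]. *)
Lemma cobounds_cup2 (D : pred G) (e : G -> G -> R) F n a b :
  subpred D K -> K a -> K b ->
  (forall x, D x -> (a * x = x * a)%g) ->
  (forall x, D x -> (b * x = x * b)%g) ->
  (forall x y, D x -> e x y = 0 /\ e y x = 0) ->
  (forall g, e g g = 0) -> e a b != 0 ->
  cobounds_on K n.+2 (cup2 e F) -> cobounds_on D n F.
Proof.
move=> DK Ka Kb Da Db De e0 eab [H bH FH].
exists (fun l => (e a b)^-1 * cycle_slant a b H l + 0).
  apply: deg_bounded_lin; first exact: cycle_slant_bounded.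
  by move=> m; exists 0 => l; rewrite normr0.
move=> l ln /allP Dl.
have cobd0 : cobd (fun=> 0 : R) l = 0.
  have := cobd_lin (-1) (fun=> 0 : R) (fun=> 0) l.
  have -> : (fun m : seq G => -1 * 0 + 0 : R) = (fun=> 0).
    by apply: funext => m; rewrite mulr0 addr0.
  by rewrite mulN1r addNr.
rewrite (cobd_lin _ (cycle_slant a b H) (fun=> 0)) cobd0 addr0.
rewrite cobd_cycle_slant //; first last.
- by move=> x /Dl; apply: Db.
- by move=> x /Dl; apply: Da.
rewrite -(@eq_cycle_slant a b (cup2 e F)) //; first last.
- by rewrite ln.
- by apply/allP => x /Dl /DK.
by rewrite cycle_slant_cup2 ?mulKf // => x /Dl Dx y; apply: De.
Qed.

End Slant.

(** * Bounded cochains as functions on words *)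

Section Bridge.
Variables (R : realType) (G : groupType).
Implicit Types (F : seq G -> R) (l : seq G).

(** The values of [f] on basis elements, read off the first [n] letters of a word
    that is padded by 1. *)
Definition word_eval n (f : bcochain R G n) l : R := cev f (nth 1%g l).

Lemma seqtup_nth l : seqtup (size l) (nth 1%g l) = l :> seq G.
Proof.
rewrite -[RHS]/(val (in_tuple l)); congr val; apply: eq_from_tnth => j.
by rewrite tnth_mktuple (tnth_nth 1%g).
Qed.

Lemma word_eval_bounded n (f : bcochain R G n) : deg_bounded (word_eval f).
Proof.
by move=> k; have [M fM] := bcochain_bounded f; exists M => l _; apply: fM.
Qed.

Definition word_functional n F : chain R G n -> R^o :=
  chain_lift (fun t => F (tval t) : R^o).
HB.instance Definition _ n F := GRing.Linear.on (@word_functional n F).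

Lemma word_functional_bounded n F M :
  (forall l, size l = n -> `|F l| <= M) ->
  word_functional F \in @bounded_functional R G n.
Proof.
move=> FM; apply/(bounded_functionalP (@word_functional n F)); exists M => t /=.
by rewrite [word_functional _ _]chain_lift_simplex FM ?size_tuple.
Qed.

Lemma word_eval_functional n F
    (bF : word_functional F \in @bounded_functional R G n) l :
  size l = n -> word_eval (Bcochain bF) l = F l.
Proof.
move=> ln; rewrite /word_eval /cev /= [word_functional _ _]chain_lift_simplex.
by subst n; rewrite seqtup_nth.
Qed.

Lemma word_eval_inj n (f g : bcochain R G n) :
  (forall l, size l = n -> word_eval f l = word_eval g l) -> f = g.
Proof.
move=> fg; apply: cev_inj => u; have := fg (mkseq u n) (size_mkseq u n).
by rewrite /word_eval (@eq_cev _ _ _ f _ u) ?(@eq_cev _ _ _ g _ u) // => i ni;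
  rewrite nth_mkseq.
Qed.

Definition word_face j l := mkseq (seqface j (nth 1%g l)) (size l).-1.

(** The later faces of [x :: y :: l] are those of [y :: l] with [x] in front; the
    face of [y :: l] that deletes [y] has no counterpart, and the third term in
    the recursion of [cobd] compensates for it. *)
Lemma cobdE F l : (0 < size l)%N ->
  cobd F l = \sum_(j < (size l).+1) (-1) ^+ j * F (word_face j l).
Proof.
elim: l F => [//|x [|y l] IH] F _.
  by rewrite !big_ord_recl big_ord0 /= expr0 expr1; ring.
rewrite cobd_cons2 IH // [in RHS]big_ord_recl big_ord_recl.
rewrite [in RHS]big_ord_recl /=.
have f0 z : word_face 0 (z :: y :: l) = y :: l.
  rewrite /word_face /= -[RHS](mkseq_nth 1%g) /=.
  by apply: eq_mkseq => i.
have f00 : word_face 0 (y :: l) = l.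
  by rewrite /word_face /= -[RHS](mkseq_nth 1%g); apply: eq_mkseq => i.
have f1 : word_face 1 (x :: y :: l) = (x * y)%g :: l.
  rewrite /word_face /= -[RHS](mkseq_nth 1%g) /=.
  by apply: eq_mkseq => -[|i].
have f2 j : word_face j.+2 (x :: y :: l) = x :: word_face j.+1 (y :: l).
  by rewrite /word_face /= /mkseq /= (iotaDl 1 0) -map_comp; congr (_ :: _).
rewrite f0 f00 f1 expr0 expr1 !mul1r mulN1r.
rewrite opprD -!addrA; congr (_ + (_ + _)).
rewrite addrA subrr add0r -sumrN; apply: eq_bigr => j _.
by rewrite /bump /= !add1n f2 [in RHS]exprS mulN1r mulNr.
Qed.

Lemma word_eval_coboundary n (f : bcochain R G n) l : size l = n.+1 ->
  word_eval (coboundary f) l = cobd (word_eval f) l.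
Proof.
move=> ln; rewrite cobdE ln // /word_eval cev_coboundary; apply: eq_bigr => j _.
congr (_ * _); apply: eq_cev => i ni; rewrite nth_mkseq // ln //.
Qed.

Lemma word_eval_cup2 n (f : bcochain R G 2) (g : bcochain R G n) x y l :
  word_eval (cochain_cup f g) [:: x, y & l] =
    word_eval f [:: x; y] * word_eval g l.
Proof.
rewrite /word_eval cev_cup exprM sqrrN expr1n expr1n mul1r; congr (_ * _).
by apply: eq_cev => -[|[|]].
Qed.

Lemma Hb_class_eq0 n (f : bcocycle R G n) :
  Hb_class f = 0 <-> is_bcoboundary f.
Proof.
rewrite -(linear0 (@Hb_class R G n)); split.
  by move=> /(@lquot_piP _ _ (@bcoboundary_pred R G n))/asboolP; rewrite subr0.
move=> fB; apply/(@lquot_piP _ _ (@bcoboundary_pred R G n))/asboolP.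
by rewrite subr0.
Qed.

Lemma coboundary_cobounds (D : pred G) n (f : bcochain R G n) :
  is_bcoboundary f -> cobounds_on D n (word_eval f).
Proof.
case: n f => [|n] f /=.
  move=> ->; exists (fun=> 0); first by move=> m; exists 0 => l; rewrite normr0.
  by move=> [|//].
move=> [h ->]; exists (word_eval h); first exact: word_eval_bounded.
by move=> l ln _; apply: word_eval_coboundary.
Qed.

Fixpoint cocycle_cups n (c : nat -> bcocycle R G 2) : bcocycle R G (n * 2) :=
  if n is m.+1 then bcocycle_cup (c 0%N) (cocycle_cups m (fun j => c j.+1))
  else Bcocycle (unit_bcochain_subproof R G).

Lemma Hb_cups_class n (c : nat -> bcocycle R G 2) :
  Hb_cups n (fun j => Hb_class (c j)) = Hb_class (cocycle_cups n c).
Proof.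
elim: n c => [//|n IH] c; rewrite /= (IH (fun j => c j.+1)).
(* The degrees [n.+1 * 2] and [2 + n * 2] agree only up to conversion. *)
exact (Hb_cup_class (c 0%N) (cocycle_cups n (fun j => c j.+1))).
Qed.

Fixpoint word_cups n (e : nat -> G -> G -> R) l : R :=
  if n is m.+1 then cup2 (e 0%N) (word_cups m (fun j => e j.+1)) l else 1.

Lemma word_eval_cocycle_cups n (c : nat -> bcocycle R G 2) e l :
  (forall j x y, word_eval (c j) [:: x; y] = e j x y) -> size l = (n * 2)%N ->
  word_eval (cocycle_cups n c) l = word_cups n e l.
Proof.
elim: n c e l => [|n IH] c e l ce.
  by move=> _; rewrite /word_eval /cev /= [unit_functional _]chain_lift_simplex.
case: l => [|x [|y l]] //= [ln]; rewrite -ce -(IH (fun j => c j.+1)) //.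
exact (word_eval_cup2 (c 0%N) (cocycle_cups n (fun j => c j.+1)) x y l).
Qed.

End Bridge.

(** * Cocycles of degree 2 vanishing on the diagonal *)

Section Homogenization.
Variables (R : realType) (G : groupType).

Definition cocycle2 (e : G -> G -> R) := forall x y z,
  e y z - e (x * y)%g z + e x (y * z)%g - e x y = 0.

Lemma cobd_cocycle2 (F : seq G -> R) x y z :
  cobd F [:: x; y; z] =
    F [:: y; z] - F [:: (x * y)%g; z] + F [:: x; (y * z)%g] - F [:: x; y].
Proof. by rewrite /=; ring. Qed.

(** From a representative [f], subtract the coboundary of [h], its pairing with
    the dyadic chains.  The self-similarity of the mean makes the difference
    vanish on the diagonal.  It cannot vanish everywhere: then [f] would be the
    coboundary of the bounded function [h]. *)
Lemma homogenized_cocycle (u : Hb R G 2) : u != 0 ->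
  exists e : G -> G -> R, [/\ exists M, forall x y, `|e x y| <= M,
    cocycle2 e, forall g, e g g = 0 & exists a b, e a b != 0].
Proof.
rewrite -(lquot_reprK u); move: (lquot_repr u) => c cN0.
have {cN0} cN : ~ is_bcoboundary c by move/Hb_class_eq0 => c0; case/eqP: cN0.
pose f x y := word_eval c [:: x; y].
have [M fM] : exists M, forall x y, `|f x y| <= M.
  have [M cM] := @word_eval_bounded _ _ _ c 2; exists M => x y; exact: cM.
pose h x := dyadic_mean (fun k => f (x ^+ (2 ^ k))%g (x ^+ (2 ^ k))%g).
have hM x : `|h x| <= M by apply: dyadic_mean_le.
have f2 : cocycle2 f.
  move=> x y z; rewrite -cobd_cocycle2 -word_eval_coboundary //.
  by rewrite bcocycle_coboundary.
have hS x : h (x * x)%g = 2 * h x - f x x.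
  rewrite [h x]dyadic_mean_shift; last by exists M.
  rewrite expn0 expg1 mulrA mulfV ?pnatr_eq0 // mul1r addrAC subrr add0r.
  by congr dyadic_mean; apply: funext => k; rewrite expnS expgnA expg2.
pose e x y := f x y - (h y - h (x * y)%g + h x).
exists e; split.
- exists (M + (M + M + M)) => x y.
  rewrite (le_trans (ler_normB _ _)) // lerD //.
  rewrite (le_trans (ler_normD _ _)) // lerD //.
  by rewrite (le_trans (ler_normB _ _)) // lerD.
- by move=> x y z; rewrite -[RHS](f2 x y z) /e mulgA; ring.
- by move=> g; rewrite /e hS; ring.
- apply: contrapT => e0; apply: cN => /=.
  have bh l : size l = 1 -> `|h (head 1%g l)| <= M by [].
  exists (Bcochain (word_functional_bounded bh)).
  apply: word_eval_inj => -[|x [|y [|//]]] // _.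
  rewrite word_eval_coboundary // cobd_cons2 !word_eval_functional //= subr0.
  apply/eqP; rewrite -subr_eq0; apply/negPn/negP => exy.
  by apply: e0; exists x, y.
Qed.

(** The cocycle identity at (1, 1, x) and (x, 1, 1) makes [e 1 x] and [e x 1]
    independent of [x]. *)
Lemma cocycle2_unit e : cocycle2 e -> e 1%g 1%g = 0 ->
  forall x, e 1%g x = 0 /\ e x 1%g = 0.
Proof.
move=> e2 e1 x; have := e2 1%g 1%g x; have := e2 x 1%g 1%g.
by rewrite !mulg1 !mul1g e1 => h1 h2; split; lra.
Qed.

End Homogenization.

(** * Cup products of classes pulled back from commuting retracts *)

Section Retracts.
Variables (R : realType) (Gs : nat -> groupType) (G : groupType).
Variables (incl : forall n, Gs n -> G) (proj : forall n, G -> Gs n).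
Hypothesis projM : forall n, {morph @proj n : x y / (x * y)%g}.
Hypothesis inclK : forall n, cancel (@incl n) (@proj n).
Hypothesis proj_incl : forall m n (a : Gs n), m != n -> proj m (incl a) = 1%g.
Hypothesis incl_comm : forall n (a : Gs n) x, proj n x = 1%g ->
  (incl a * x = x * incl a)%g.

Lemma proj_one n : proj n 1%g = 1%g.
Proof. by apply: (@mulgI _ (proj n 1%g)); rewrite -projM !mulg1. Qed.

Definition tail_group m : pred G :=
  fun x => `[< forall j, (j < m)%N -> proj j x = 1%g >].

(** Induction on the number of factors, generalised over the index [m] of the
    first one: cancelling it shrinks [tail_group m] to [tail_group m.+1], whose
    elements commute with the [m]-th factor and project trivially to it.  In
    degree 0 the cochain 1 remains, and there coboundaries are zero. *)
Lemma word_cups_not_cobounds (e : forall n, Gs n -> Gs n -> R) n m :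
  (forall n g, e n g g = 0) -> (forall n, cocycle2 (@e n)) ->
  (forall n, exists a b, e n a b != 0) ->
  ~ cobounds_on (tail_group m) (n * 2)
      (word_cups n (fun j x y => e (m + j)%N (proj _ x) (proj _ y))).
Proof.
move=> eg e2 eN; elim: n m => [|n IH] m.
  move=> [H _ /(_ [::] erefl isT)] /= /eqP; by rewrite oner_eq0.
rewrite /= => cob; apply: (IH m.+1).
have [a [b eab]] := eN (m + 0)%N.
have -> : (fun j x y => e (m.+1 + j)%N (proj _ x) (proj _ y)) =
  (fun j x y => e (m + j.+1)%N (proj _ x) (proj _ y)).
  by apply: funext => j; rewrite addnS.
have p1 x : tail_group m.+1 x -> proj (m + 0) x = 1%g.
  by move/asboolP; apply; rewrite addn0.
apply: (@cobounds_cup2 _ _ (tail_group m) _ _ (tail_group m.+1) _ _ _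
  (incl a) (incl b)) cob.
- by apply/asboolP => j _; apply: proj_one.
- move=> x y /asboolP Kx /asboolP Ky; apply/asboolP => j jm.
  by rewrite projM Kx // Ky // mulg1.
- by move=> x /asboolP Kx; apply/asboolP => j jm; apply: Kx; rewrite ltnS ltnW.
- apply/asboolP => j jm.
  by rewrite proj_incl // addn0 ltn_eqF.
- apply/asboolP => j jm.
  by rewrite proj_incl // addn0 ltn_eqF.
- by move=> x /p1; apply: incl_comm.
- by move=> x /p1; apply: incl_comm.
- by move=> x y /p1 ->; apply: cocycle2_unit.
- by move=> g; apply: eg.
- by rewrite !inclK.
Qed.

(** Pulls the detecting cocycles back to [G] along the projections and cups
    them there; [tail_group 0] is all of [G]. *)
Lemma nonzero_cups : (forall n, exists x : Hb R (Gs n) 2, x != 0) ->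
  exists phi : nat -> Hb R G 2, forall n, Hb_cups n phi != 0.
Proof.
move=> hGs.
have he n : exists e : Gs n -> Gs n -> R,
    [/\ exists M, forall x y, `|e x y| <= M, cocycle2 e,
        forall g, e g g = 0 & exists a b, e a b != 0].
  by have [x /homogenized_cocycle] := hGs n.
pose e n := sval (cid (he n)).
have eP n : [/\ exists M, forall x y, `|e n x y| <= M, cocycle2 (e n),
    forall g, e n g g = 0 & exists a b, e n a b != 0] := svalP (cid (he n)).
have hc n : exists c : bcocycle R G 2,
    forall x y, word_eval c [:: x; y] = e n (proj n x) (proj n y).
  have [[M eM] e2 _ _] := eP n.
  have bF l : size l = 2 ->
      `|cup2 (fun x y => e n (proj n x) (proj n y)) (fun=> 1) l| <= M.
    by case: l => [|x [|y [|//]]] //= _; rewrite mulr1.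
  pose f := Bcochain (word_functional_bounded bF).
  have fE x y : word_eval f [:: x; y] = e n (proj n x) (proj n y).
    by rewrite word_eval_functional //= mulr1.
  suff f0 : f \in @bcocycle_pred R G 2 by exists (Bcocycle f0).
  apply/eqP/word_eval_inj => -[|x [|y [|z [|//]]]] // _.
  by rewrite word_eval_coboundary // cobd_cocycle2 !fE !projM e2.
pose c n := sval (cid (hc n)).
have cE n x y : word_eval (c n) [:: x; y] = e n (proj n x) (proj n y).
  exact: svalP (cid (hc n)) x y.
exists (fun n => Hb_class (c n)) => n; rewrite Hb_cups_class.
apply/negP => /eqP/Hb_class_eq0/(@coboundary_cobounds _ _ (tail_group 0)).
move=> [H bH cH]; apply: (@word_cups_not_cobounds e n 0%N).
- by move=> k; have [] := eP k.
- by move=> k; have [] := eP k.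
- by move=> k; have [] := eP k.
- exists H => // l ln Dl; rewrite -cH //; symmetry.
  exact: word_eval_cocycle_cups.
Qed.
End Retracts.

(** * The factors of direct sums and products *)

Section Factors.
Variable Gs : nat -> groupType.

Definition prod_incl n (a : Gs n) : gprod Gs := dfwith (fun m => 1%g : Gs m) a.

Lemma prod_inclK n : cancel (@prod_incl n) (fun x => x n).
Proof. by move=> a; rewrite /prod_incl dfwith_in. Qed.

Lemma prod_incl_out m n (a : Gs n) : m != n -> prod_incl a m = 1%g.
Proof. by move=> mn; rewrite /prod_incl dfwith_out // eq_sym. Qed.

Lemma prod_incl_comm n (a : Gs n) (x : gprod Gs) : x n = 1%g ->
  (prod_incl a * x = x * prod_incl a)%g.
Proof.
move=> xn; apply: functional_extensionality_dep => m.
change (prod_incl a m * x m = x m * prod_incl a m)%g.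
have [->|mn] := eqVneq m n; first by rewrite xn mulg1 mul1g.
by rewrite prod_incl_out // mulg1 mul1g.
Qed.

Lemma prod_incl_finite n (a : Gs n) : prod_incl a \in @finite_support Gs.
Proof.
apply/asboolP; apply: (@sub_finite_set _ _ [set n]%classic).
  move=> m /= /eqP am; apply: contrapT => /eqP mn; apply: am.
  exact: prod_incl_out.
exact: finite_set1.
Qed.

End Factors.

Lemma bcd_cups (R : realType) (G : groupType) (phi : nat -> Hb R G 2) :
  (forall n, Hb_cups n phi != 0) -> bcd R G = +oo%E.
Proof.
move=> phiN; apply: eq_infty => r; pose n := (Num.truncn r).+1.
have rn : r <= (n * 2)%:R.
  by rewrite ltW // (lt_le_trans (truncnS_gt r)) // ler_nat leq_pmulr.
rewrite -lee_fin in rn; apply: (le_trans rn); apply: ereal_sup_ubound.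
by exists (n * 2)%N => //=; exists (Hb_cups n phi).
Qed.

Theorem proposition1p5 (R : realType) (Gs : nat -> groupType) (G : groupType)
    (hGs : forall n : nat, exists x : Hb R (Gs n) 2, x != 0)
    (hG : G = direct_sum Gs \/ G = direct_product Gs) :
  bcd R G = +oo%E /\
  exists phi : nat -> Hb R G 2, forall n : nat, Hb_cups n phi != 0.
Proof.
suff [phi phiN] : exists phi : nat -> Hb R G 2, forall n, Hb_cups n phi != 0.
  by split; [exact: bcd_cups phiN | exists phi].
case: hG => ->.
- apply: (@nonzero_cups R Gs (direct_sum Gs)
    (fun n a => Gsum (prod_incl_finite a)) (fun n x => gsum_val x n)) => //.
  + by move=> n a; apply: prod_inclK.
  + by move=> m n a; apply: prod_incl_out.
  + by move=> n a x xn; apply: val_inj; apply: prod_incl_comm.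
- apply: (@nonzero_cups R Gs (direct_product Gs)
    (@prod_incl Gs) (fun n x => x n)) => //.
  + exact: prod_inclK.
  + exact: prod_incl_out.
  + exact: prod_incl_comm.
Qed.
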